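(* Let $f=\frac1M\sum_{i=1}^M f_i$ where each $f_i:\mathbb{R}^n\to\mathbb{R}$ is continuously differentiable, and suppose that $f$ has a minimizer $x_*$, that $\nabla f$ is Lipschitz continuous with constant $L>0$, and that $f$ is strongly convex with parameter $\mu>0$. Suppose that there are constants $\beta_1\ge0$ and $\beta_2\ge1$ such that $$\|\nabla f_i(x)\|^2\le\beta_1+\beta_2\|\nabla f(x)\|^2\quad\text{for all }x\in\mathbb{R}^n\text{ and } i=1,\dots,M.$$ Let $x_0\in\mathbb{R}^n$, let $(\mathcal{B}_k)_{k\ge0}$ be a sequence of nonempty subsets of $\{1,\dots,M\}$, and let $$x_{k+1}=x_k-\frac1L g_k,\qquad g_k=\frac{1}{|\mathcal{B}_k|}\sum_{i\in\mathcal{B}_k}\nabla f_i(x_k),\qquad k\ge0.$$ Suppose that for some $\rho$ with $0<\rho\le\mu/L$ the sample sizes satisfy, at each iteration $k=0,1,\dots$, $$4\left(\frac{M-|\mathcal{B}_k|}{M}\right)^2\big(\beta_1+2\beta_2L[f(x_k)-f(x_* )]\big)\le L(\mu/L-\rho)[f(x_k)-f(x_* )].$$ Then for all $k\ge0$, $$f(x_{k+1})-f(x_* )\le(1-\rho)[f(x_k)-f(x_* )].$$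
   Context: $\|\cdot\|$ is the Euclidean norm on $\mathbb{R}^n$ and $|\mathcal{B}|$ is the cardinality of $\mathcal{B}$. Lipschitz continuity of the gradient with constant $L$ means $\|\nabla f(x)-\nabla f(y)\|\le L\|x-y\|$ for all $x,y\in\mathbb{R}^n$. Strong convexity with parameter $\mu$ means $f(y)\ge f(x)+(y-x)^T\nabla f(x)+\frac{\mu}{2}\|y-x\|^2$ for all $x,y\in\mathbb{R}^n$. *)

(* Defs.v *)
From mathcomp Require Export all_boot all_order all_algebra.
From mathcomp Require Export all_classical all_reals all_analysis.
Export Order.TTheory GRing.Theory Num.Theory.
Export numFieldNormedType.Exports.

Set Implicit Arguments.
Unset Strict Implicit.
Unset Printing Implicit Defensive.

Local Open Scope ring_scope.

Section Euclidean.
Context {R : realType} {n : nat}.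
Implicit Types (u v x y : 'rV[R]_n) (f : 'rV[R]_n -> R).

Definition dotv u v : R := \sum_(j < n) u 0 j * v 0 j.

(* The library norm [`|u|] on row vectors is the sup norm; it induces the same
   topology as [enorm], so [differentiable] and [continuous] are unaffected. *)
Definition enorm u : R := Num.sqrt (dotv u u).

Definition gradient f x : 'rV[R]_n := \row_(j < n) 'D_(delta_mx 0 j) f x.

Definition continuously_differentiable f : Prop :=
  (forall x, differentiable f x) /\ continuous (gradient f).

Definition minimizer f x : Prop := forall y, f x <= f y.

Definition lipschitz_gradient (L : R) f : Prop :=
  forall x y, enorm (gradient f x - gradient f y) <= L * enorm (x - y).

Definition strongly_convex (mu : R) f : Prop :=
  forall x y,
    f x + dotv (y - x) (gradient f x) + mu / 2 * enorm (y - x) ^+ 2 <= f y.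

End Euclidean.

(* Main.v *)
(** By the descent lemma, a step along [g = grad f + e] with step size [1/L]
    decreases [f] by at least [(|grad f|^2 - |e|^2) / (2 L)].  Strong convexity
    gives [|grad f|^2 >= 2 mu (f - min f)].  The error [e] is a combination of the
    [grad f_i] with coefficients of total mass [2 (M - |B|) / M], so its square
    is at most [4 ((M - |B|) / M)^2] times the bound on [|grad f_i|^2], which is
    controlled by [f - min f] since [|grad f|^2 <= 2 L (f - min f)]. *)

From mathcomp Require Import ring lra.
Require Import Defs.
Local Open Scope ring_scope.

Section DotProduct.
Context {R : realType} {n : nat}.
Implicit Types (u v w : 'rV[R]_n) (a : R).

Lemma dotvC u v : dotv u v = dotv v u.
Proof. by apply: eq_bigr => j _; rewrite mulrC. Qed.

Lemma dotvDl u v w : dotv (u + v) w = dotv u w + dotv v w.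
Proof. by rewrite -big_split; apply: eq_bigr => j _; rewrite mxE mulrDl. Qed.

Lemma dotvZl a u v : dotv (a *: u) v = a * dotv u v.
Proof. by rewrite mulr_sumr; apply: eq_bigr => j _; rewrite mxE mulrA. Qed.

Lemma dotvBl u v w : dotv (u - v) w = dotv u w - dotv v w.
Proof. by rewrite -scaleN1r dotvDl dotvZl mulN1r. Qed.

Lemma dotv_suml (I : finType) (F : I -> 'rV[R]_n) w :
  dotv (\sum_i F i) w = \sum_i dotv (F i) w.
Proof.
rewrite exchange_big; apply: eq_bigr => j _ /=.
by rewrite summxE mulr_suml.
Qed.

Lemma dotvDr u v w : dotv w (u + v) = dotv w u + dotv w v.
Proof. by rewrite dotvC dotvDl !(dotvC w). Qed.

Lemma dotvZr a u v : dotv u (a *: v) = a * dotv u v.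
Proof. by rewrite dotvC dotvZl dotvC. Qed.

Lemma dotvBr u v w : dotv w (u - v) = dotv w u - dotv w v.
Proof. by rewrite dotvC dotvBl !(dotvC w). Qed.

Lemma dotv_sumr (I : finType) (F : I -> 'rV[R]_n) w :
  dotv w (\sum_i F i) = \sum_i dotv w (F i).
Proof. by rewrite dotvC dotv_suml; apply: eq_bigr => i _; rewrite dotvC. Qed.

Lemma dotvv_ge0 u : 0 <= dotv u u.
Proof. by apply: sumr_ge0 => j _; rewrite -expr2 sqr_ge0. Qed.

Lemma sqr_enorm u : enorm u ^+ 2 = dotv u u.
Proof. by rewrite sqr_sqrtr // dotvv_ge0. Qed.

Lemma dotv_le u v : dotv u v <= (dotv u u + dotv v v) / 2.
Proof.
have := dotvv_ge0 (u - v); rewrite dotvBl !dotvBr (dotvC v u); lra.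
Qed.

(** The two signs come from [dotv_le] at [u] and at [- u]; a common bound on the squares avoids
    square roots. *)
Lemma normr_dotv_le (G : R) u v :
  dotv u u <= G -> dotv v v <= G -> `|dotv u v| <= G.
Proof.
move=> hu hv; rewrite ler_norml.
have := dotv_le u v; have := dotv_le (-1 *: u) v.
rewrite !(dotvZl, dotvZr) => h1 h2; apply/andP; split; lra.
Qed.

(** Young's inequality [dotv_le] for [u] and [a *: v] gives [a * dotv u v <= a ^+ 2 * dotv v v];
    then [a] cancels. *)
Lemma dotv_le_scale a u v : 0 < a ->
  enorm u <= a * enorm v -> dotv u v <= a * dotv v v.
Proof.
move=> a0 h; have hsq : dotv u u <= a ^+ 2 * dotv v v.
  rewrite -!sqr_enorm -exprMn; apply: lerXn2r => //; rewrite nnegrE ?sqrtr_ge0 //.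
  by rewrite mulr_ge0 ?sqrtr_ge0 // ltW.
have := dotv_le u (a *: v); rewrite !(dotvZl, dotvZr) => h2.
have : a * dotv u v <= a * (a * dotv v v) by lra.
by rewrite ler_pM2l.
Qed.

(** Both sides expand into double sums, compared term by term: the [(i, j)] term is at most
    [|c i| |c j| G] by [normr_dotv_le]. *)
Lemma sqr_comb_le (I : finType) (c : I -> R) (F : I -> 'rV[R]_n) (G : R) :
  (forall i, dotv (F i) (F i) <= G) ->
  dotv (\sum_i c i *: F i) (\sum_i c i *: F i) <= (\sum_i `|c i|) ^+ 2 * G.
Proof.
move=> hF; rewrite dotv_suml expr2 -mulrA mulr_suml; apply: ler_sum => i _.
rewrite mulr_suml mulr_sumr dotv_sumr; apply: ler_sum => j _.
rewrite dotvZl dotvZr; apply: le_trans (ler_norm _) _.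
by rewrite !normrM !ler_wpM2l // normr_dotv_le.
Qed.

End DotProduct.

Section Descent.
Context {R : realType} {n : nat}.
Implicit Types (f : 'rV[R]_n -> R) (x d v : 'rV[R]_n).

Lemma derive_dotv f x v : differentiable f x -> 'D_v f x = dotv (gradient f x) v.
Proof.
move=> df; rewrite deriveE // {1}(row_sum_delta v) linear_sum.
by apply: eq_bigr => j _; rewrite linearZ mxE deriveE // mulrC.
Qed.

(** The difference quotient of the restriction to the line is exactly that of [f] at [x + t *: d] in
    direction [d]. *)
Lemma is_derive_line f x d (t : R) : differentiable f (x + t *: d) ->
  is_derive t 1 (fun s : R => f (x + s *: d)) (dotv (gradient f (x + t *: d)) d).
Proof.
move=> df; have eq_quotient :
    (fun h : R => h^-1 *: (((fun s : R => f (x + s *: d)) \o shift t) (h *: 1)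
       - f (x + t *: d)))
    = (fun h : R => h^-1 *: ((f \o shift (x + t *: d)) (h *: d)
       - f (x + t *: d))).
  apply/funext => h /=; congr (_ *: (f _ - _)).
  by rewrite [h *: 1]mulr1 scalerDl addrCA.
split; first by rewrite /derivable eq_quotient; exact: diff_derivable.
by rewrite /derive eq_quotient -derive_dotv.
Qed.

(** The mean value theorem on [0, 1] is applied to [f (x + s *: d)] minus [c * s ^+ 2]. The
    Lipschitz bound contributes at most [L * s * dotv d d] to the slope, which the derivative of the
    subtracted quadratic cancels exactly. *)
Lemma descent_lemma (L : R) f x d : 0 < L -> (forall z, differentiable f z) ->
  lipschitz_gradient L f ->
  f (x + d) <= f x + dotv (gradient f x) d + L / 2 * dotv d d.
Proof.
move=> L0 df lipf; pose c := L / 2 * dotv d d.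
pose phi : R -> R := (fun s : R => f (x + s *: d)) - c \*: (id ^+ 2 : R -> R).
pose dphi s := dotv (gradient f (x + s *: d)) d - c *: (2%:R * s ^+ 1 *: (1 : R)).
have phi' (s : R) : is_derive s 1 phi (dphi s).
  exact: is_deriveB (is_derive_line f x d s (df _)) _.
have cphi : {within `[0, 1], continuous phi}%classic.
  by apply: derivable_within_continuous => s _; case: (phi' s).
have [s] := MVT ltr01 (fun s _ => phi' s) cphi.
rewrite in_itv /= => /andP[s0 _].
have -> : phi 1 = f (x + d) - c * 1 ^+ 2 by rewrite -[in RHS](scale1r d).
have -> : phi 0 = f x - c * 0 ^+ 2 by rewrite -[in RHS](addr0 x) -(scale0r d).
have -> : dphi s = dotv (gradient f (x + s *: d)) d - c * (2 * s ^+ 1 * 1) by [].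
have : dotv (gradient f (x + s *: d) - gradient f x) d <= L * s * dotv d d.
  (* The factor [L * s] is positive because the mean value point lies in the open interval. *)
  apply: dotv_le_scale; first exact: mulr_gt0.
  apply: le_trans (lipf _ _) _; rewrite addrAC subrr add0r /enorm.
  rewrite dotvZl dotvZr mulrA -expr2 sqrtrM ?sqr_ge0 // sqrtr_sqr.
  by rewrite gtr0_norm // mulrA.
rewrite dotvBl /c; lra.
Qed.

(* Minimise the quadratic upper bound of the descent lemma. *)
Lemma sqr_gradient_le (L : R) f x xstar : 0 < L ->
  (forall z, differentiable f z) -> lipschitz_gradient L f ->
  minimizer f xstar ->
  dotv (gradient f x) (gradient f x) <= 2 * L * (f x - f xstar).
Proof.
move=> L0 df lipf /(_ (x + - L^-1 *: gradient f x)) hmin.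
have := descent_lemma L f x (- L^-1 *: gradient f x) L0 df lipf.
rewrite !(dotvZl, dotvZr); set G := dotv _ _ => h.
(* The parenthesis is the decrease guaranteed by the step, equal to [G / (2 * L)]. *)
have -> : G = 2 * L * (L^-1 * G - L / 2 * (L^-1 * (L^-1 * G))).
  by field; rewrite gt_eqF.
by rewrite ler_pM2l ?mulr_gt0 //; lra.
Qed.

(* Minimise the quadratic lower bound given by strong convexity. *)
Lemma polyak_lojasiewicz (mu : R) f x y : 0 < mu -> strongly_convex mu f ->
  2 * mu * (f x - f y) <= dotv (gradient f x) (gradient f x).
Proof.
move=> mu0 /(_ x y); rewrite sqr_enorm; move: (y - x) => d h.
(* Completing the square: the quadratic lower bound is least where this vector vanishes. *)
have := dotvv_ge0 (gradient f x + mu *: d).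
rewrite !(dotvDl, dotvDr, dotvZl, dotvZr) (dotvC (gradient f x) d) => h2.
have : 2 * mu * (f x + dotv d (gradient f x) + mu / 2 * dotv d d) <= 2 * mu * f y.
  by rewrite ler_pM2l ?mulr_gt0.
lra.
Qed.

(** After scaling the descent lemma by [2 * L], the terms in [g] are [|g|^2 - 2 <grad f, g>], which
    equals [|g - grad f|^2 - |grad f|^2]. *)
Lemma inexact_gradient_step (L : R) f x g : 0 < L ->
  (forall z, differentiable f z) -> lipschitz_gradient L f ->
  2 * L * f (x - L^-1 *: g) <= 2 * L * f x
    - dotv (gradient f x) (gradient f x)
    + dotv (g - gradient f x) (g - gradient f x).
Proof.
move=> L0 df lipf; rewrite -scaleNr.
have := descent_lemma L f x (- L^-1 *: g) L0 df lipf.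
rewrite -(ler_pM2l (mulr_gt0 (ltr0n R 2) L0)) => /le_trans; apply.
rewrite !(dotvBl, dotvBr, dotvZl, dotvZr) (dotvC g (gradient f x)).
set a := dotv _ g; set b := dotv g g.
suff -> : 2 * L * (f x + - L^-1 * a + L / 2 * (- L^-1 * (- L^-1 * b)))
  = 2 * L * f x - 2 * a + b by lra.
by field; rewrite gt_eqF.
Qed.

End Descent.

Section Sampling.
Context {R : realType} {n M : nat}.
Implicit Types (B : {set 'I_M}) (F : 'I_M -> 'rV[R]_n).

(** The weights are [1/|B| - 1/M >= 0] on [B] and [- 1/M] off [B]; each group has total mass
    [(M - |B|) / M] in absolute value. *)
Lemma sum_sampling_weights B : B != finset.set0 ->
  \sum_(i < M) `|(i \in B)%:R / #|B|%:R - M%:R^-1| =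
    2 * ((M%:R - #|B|%:R) / M%:R) :> R.
Proof.
rewrite -card_gt0 => B0.
have BM : (#|B| <= M)%N by rewrite -[X in (_ <= X)%N]card_ord max_card.
have b0 : (0 : R) < #|B|%:R by rewrite ltr0n.
have M0 : (0 : R) < M%:R by rewrite ltr0n (leq_trans B0).
have bM : M%:R^-1 <= #|B|%:R^-1 :> R by rewrite lef_pV2 ?ler_nat.
rewrite (bigID (mem B)) /=.
rewrite (eq_bigr (fun=> #|B|%:R^-1 - M%:R^-1)) => [|i ->]; last first.
  by rewrite mul1r ger0_norm ?subr_ge0.
rewrite [X in _ + X](eq_bigr (fun=> M%:R^-1)) => [|i /negbTE ->]; last first.
  by rewrite mul0r sub0r normrN ger0_norm // invr_ge0 ltW.
rewrite !sumr_const.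
have -> : #|[pred i | i \notin B]| = (M - #|B|)%N.
  by rewrite -[X in (X - _)%N]card_ord -(cardC (mem B)) addKn.
rewrite -(mulr_natr (_ - _)) -(mulr_natr M%:R^-1) natrB //.
by field; rewrite !gt_eqF.
Qed.

Lemma sampling_error B F (G : R) (e : 'rV[R]_n) : B != finset.set0 ->
  (forall i, dotv (F i) (F i) <= G) ->
  e = #|B|%:R^-1 *: (\sum_(i in B) F i) - M%:R^-1 *: \sum_(i < M) F i ->
  dotv e e <= 4 * ((M%:R - #|B|%:R) / M%:R) ^+ 2 * G.
Proof.
move=> B0 hF he.
(* Both averages become one sum over all indices, so that terms of [B] partly cancel before absolute
   values are taken. *)
have -> : e = \sum_(i < M) ((i \in B)%:R / #|B|%:R - M%:R^-1) *: F i.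
  rewrite he big_mkcond !scaler_sumr -sumrB; apply: eq_bigr => i _.
  by case: (i \in B); rewrite scalerBl ?mul1r ?mul0r ?scaler0 ?scale0r.
apply: le_trans (sqr_comb_le _ _ F G hF) _.
by rewrite sum_sampling_weights // exprMn -natrX.
Qed.

End Sampling.

Section AverageGradient.
Context {R : realType} {n M : nat}.
Variables (fi : 'I_M -> 'rV[R]_n -> R) (f : 'rV[R]_n -> R).
Hypothesis hf : forall z, f z = M%:R^-1 * \sum_(i < M) fi i z.
Hypothesis dfi : forall i z, differentiable (fi i) z.

(** An equality of functions, the form to which the differentiation rules apply. *)
Let fE : f = M%:R^-1 \*: \sum_(i < M) fi i.
Proof. by apply/funext => z; rewrite hf /= fct_sumE. Qed.

Lemma differentiable_average z : differentiable f z.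
Proof.
by rewrite fE; apply: differentiableZ; apply: differentiable_sum.
Qed.

Lemma gradient_average z :
  gradient f z = M%:R^-1 *: \sum_(i < M) gradient (fi i) z.
Proof.
apply/rowP => j; rewrite !mxE summxE fE deriveZ; last first.
  by apply: derivable_sum => i; exact: diff_derivable.
rewrite derive_sum => [|i]; last exact: diff_derivable.
by congr (_ * _); apply: eq_bigr => i _; rewrite mxE.
Qed.

End AverageGradient.


Theorem corollary3p2 (R : realType) (n M : nat)
    (fi : 'I_M -> 'rV[R]_n -> R) (f : 'rV[R]_n -> R)
    (xstar : 'rV[R]_n) (L mu beta1 beta2 rho : R)
    (x0 : 'rV[R]_n) (B : nat -> {set 'I_M}) (x g : nat -> 'rV[R]_n)
    (hf : forall z, f z = M%:R^-1 * \sum_(i < M) fi i z)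
    (hfi : forall i, continuously_differentiable (fi i))
    (hxstar : minimizer f xstar)
    (hL : 0 < L) (hLip : lipschitz_gradient L f)
    (hmu : 0 < mu) (hconv : strongly_convex mu f)
    (hbeta1 : 0 <= beta1) (hbeta2 : 1 <= beta2)
    (hbeta : forall z i,
      enorm (gradient (fi i) z) ^+ 2 <=
        beta1 + beta2 * enorm (gradient f z) ^+ 2)
    (hB : forall k, B k != finset.set0)
    (hx0 : x 0%N = x0)
    (hx : forall k, x k.+1 = x k - L^-1 *: g k)
    (hg : forall k,
      g k = #|B k|%:R^-1 *: \sum_(i in B k) gradient (fi i) (x k))
    (hrho0 : 0 < rho) (hrho : rho <= mu / L)
    (hsample : forall k,
      4 * ((M%:R - #|B k|%:R) / M%:R) ^+ 2
        * (beta1 + 2 * beta2 * L * (f (x k) - f xstar))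
      <= L * (mu / L - rho) * (f (x k) - f xstar)) :
  forall k, f (x k.+1) - f xstar <= (1 - rho) * (f (x k) - f xstar).
Proof.
move=> k.
have dfi i z : differentiable (fi i) z by case: (hfi i).
have df := differentiable_average fi f hf dfi.
set D := f (x k) - f xstar; pose G := dotv (gradient f (x k)) (gradient f (x k)).
have D0 : 0 <= D by rewrite subr_ge0.
have GL : G <= 2 * L * D by exact: sqr_gradient_le.
have Gmu : 2 * mu * D <= G by exact: polyak_lojasiewicz.
have G_fi i : dotv (gradient (fi i) (x k)) (gradient (fi i) (x k))
    <= beta1 + 2 * beta2 * L * D.
  rewrite -sqr_enorm; apply: le_trans (hbeta _ _) _; rewrite sqr_enorm -/G.
  have : beta2 * G <= beta2 * (2 * L * D).
    by rewrite ler_wpM2l // (le_trans ler01).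
  lra.
have eE : g k - gradient f (x k) = #|B k|%:R^-1 *:
      (\sum_(i in B k) gradient (fi i) (x k))
    - M%:R^-1 *: \sum_(i < M) gradient (fi i) (x k).
  by rewrite hg (gradient_average fi f hf dfi).
have err := le_trans (sampling_error _ _ _ _ (hB k) G_fi eE) (hsample k).
have := inexact_gradient_step L f (x k) (g k) hL df hLip.
rewrite -hx -/G => step.
have Lmu : L * (mu / L - rho) * D = mu * D - L * rho * D.
  by field; rewrite gt_eqF.
(* The bounds add up to [2 * L * D - mu * D - L * rho * D] for [2 * L] times the new gap. The
   condition [rho <= mu / L] lets [mu * D] be replaced by [L * rho * D], which leaves
   [2 * L * (1 - rho) * D]. *)
have slack : 0 <= L * (mu / L - rho) * D.
  by rewrite mulr_ge0 // mulr_ge0 ?subr_ge0 // ltW.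
rewrite -(ler_pM2l (mulr_gt0 (ltr0n R 2) hL)).
rewrite -/D Lmu in err; rewrite Lmu in slack; rewrite /D in err slack Gmu *; lra.
Qed.
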